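(* Let $\theta \in (-\pi/2,\pi/2]$, $K>1$, $c\in\mathbb{C}$ and let $f(z)=h_{K,\theta}(z)^2+c$. Then, with $K_\theta>1$ the same constant as for the map $H=h_{K,\theta}^2$ (recalled in the context; it does not depend on $c$): (a) for $K<K_\theta$, there is one fixed external ray of $f$, and it is locally repelling; (b) for $K=K_\theta$, there are two fixed external rays of $f$, one of which is locally repelling and one of which is neutral; further, the neutral fixed external ray is repelling on one side and attracting on the other; (c) for $K>K_\theta$, there are three fixed external rays of $f$, one of which is locally attracting and two of which are locally repelling.
   Context: For $K>1$ and $\theta\in(-\pi/2,\pi/2]$, $h_{K,\theta}(z)=\frac{K+1}{2}z+e^{2i\theta}\frac{K-1}{2}\overline{z}$, and $H=h_{K,\theta}^2$. A ray is $R_\varphi=\{te^{i\varphi}:t\ge0\}$. $H$ sends rays to rays and induces $\widetilde H:\mathbb{R}/2\pi\mathbb{Z}\to\mathbb{R}/2\pi\mathbb{Z}$, $\widetilde H(\varphi)=\arg H(re^{i\varphi})$ (any $r>0$). A ray $R_\phi$ is fixed by $H$ if $\widetilde H(\phi)=\phi$; a fixed ray is locally attracting, locally repelling or neutral if $\widetilde H'(\phi)<1$, $>1$ or $=1$ respectively. A neutral fixed ray $R_\phi$ is attracting on one side if there is a half-open interval with endpoint $\phi$ on that side all of whose points converge to $\phi$ under iteration of $\widetilde H$; it is repelling on one side if there is a half-open interval with endpoint $\phi$ on that side such that every point of it other than $\phi$ eventually leaves the interval under iteration of $\widetilde H$. The constant $K_\theta$: by a preceding theorem, for each $\theta\in(-\pi/2,\pi/2]$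 there is $K_\theta>1$ such that $H$ has one fixed ray, which is locally repelling, for $K<K_\theta$; two fixed rays, one locally repelling and one neutral (the latter repelling on one side and attracting on the other), for $K=K_\theta$; and three fixed rays, one locally attracting and two locally repelling, for $K>K_\theta$. Böttcher coordinate (known from earlier work): for each $K,\theta,c$ there are a neighbourhood $U$ of infinity with $f(U)\subset U$ and a quasiconformal map $\psi$ from $U$ onto a neighbourhood $\psi(U)$ of infinity, with $\psi(z)\to\infty$ as $z\to\infty$, such that $H(\psi(z))=\psi(f(z))$ for $z\in U$. Fix such $U,\psi$. The external ray of $f$ with angle $\varphi\in[0,2\pi)$ is $E_\varphi=\psi^{-1}(R_\varphi\cap\psi(U))$, defined only in a neighbourhood of infinity. An external ray is fixed by $f$ if $f(E_\varphi)\subset E_\varphi$. A fixed external ray $E_\varphi$ is called locally attracting, locally repelling, neutral, or attracting/repelling on one side if the corresponding fixed ray $R_\varphi$ of $H$ has that property.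
   Formalization: K_θ is taken as any number with the property recalled for H, for the given θ; no such number exists for θ=0 (at K=2 the only fixed ray is neutral) or θ=π/2 (one repelling fixed ray for all K>1), so the result is for the remaining θ, 0<|θ|<π/2. *)

(* Defs.v *)
From HB Require Import structures.
From mathcomp Require Import all_boot all_order all_algebra.
From mathcomp Require Import all_classical all_reals all_analysis.
From mathcomp Require Import complex.

Set Implicit Arguments.
Unset Strict Implicit.
Unset Printing Implicit Defensive.

Import Order.TTheory GRing.Theory Num.Theory.
Import numFieldNormedType.Exports.

Local Open Scope classical_set_scope.
Local Open Scope ring_scope.
Local Open Scope complex_scope.

(* MathComp-Analysis, with the complex numbers R[i] over R : realType.
   In R[i], the modulus `|z| is a complex number with zero imaginary part, and
   x <= y means that y - x is a nonnegative real; hence the casts r%:C below.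
   R[i]^o is R[i] with the topology of its modulus. *)

Section Maps.
Context {R : realType}.
Implicit Types (K theta a b phi x : R) (c z : R[i]).

Definition expi a : R[i] := cos a +i* sin a.

Definition hmap K theta z : R[i] :=
  ((K + 1) / 2)%:C * z + expi (2 * theta) * ((K - 1) / 2)%:C * z^*.

Definition Hmap K theta z : R[i] := hmap K theta z ^+ 2.

Definition fmap_c K theta c z : R[i] := hmap K theta z ^+ 2 + c.

(* The circle R/2piZ is represented by [0, 2pi[. *)
Definition angles : set R := [set a | 0 <= a < 2 * pi].

(* The argument of z in [0, 2pi[, for z != 0. *)
Definition arg z : R := xget 0 [set a | angles a /\ z = `|z| * expi a].

Definition mod2pi a : R := arg (expi a).

(* The representative of a - b modulo 2pi in ]-pi, pi]. *)
Definition angle_sub a b : R :=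
  let d := mod2pi (a - b) in if d <= pi then d else d - 2 * pi.

Definition ray phi : set R[i] :=
  [set z | exists2 t : R, 0 <= t & z = t%:C * expi phi].

(* The circle map induced by H, as a 2pi-periodic function with values in
   [0, 2pi[; the argument does not depend on the radius, taken to be 1. *)
Definition Htilde K theta phi : R := arg (Hmap K theta (expi phi)).

(* l is the derivative at phi of Htilde as a map of the circle; the difference
   is taken modulo 2pi, since the values of Htilde in [0, 2pi[ may jump. *)
Definition Htilde_deriv K theta phi (l : R) : Prop :=
  is_derive phi (1 : R)
    (fun x : R => angle_sub (Htilde K theta x) (Htilde K theta phi)) l.

Definition locally_attracting K theta phi : Prop :=
  exists2 l, Htilde_deriv K theta phi l & l < 1.

Definition locally_repelling K theta phi : Prop :=
  exists2 l, Htilde_deriv K theta phi l & 1 < l.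

Definition neutral K theta phi : Prop := Htilde_deriv K theta phi 1.

(* The half-open arc of length d with endpoint phi (included): [phi, phi + d[
   for s = false, ]phi - d, phi] for s = true, modulo 2pi. *)
Definition half_open_arc (s : bool) phi (d : R) : set R :=
  [set x | exists2 t : R, 0 <= t < d & x = mod2pi (phi + (-1) ^+ s * t)].

Definition attracting_on_side K theta (s : bool) phi : Prop :=
  exists2 d : R, 0 < d < 2 * pi & forall x, half_open_arc s phi d x ->
    (fun n => angle_sub (iter n (Htilde K theta) x) phi) @ \oo --> (0 : R).

Definition repelling_on_side K theta (s : bool) phi : Prop :=
  exists2 d : R, 0 < d < 2 * pi & forall x, half_open_arc s phi d x ->
    x <> mod2pi phi ->
    exists n, ~ half_open_arc s phi d (iter n (Htilde K theta) x).

(* Below, rays are counted as subsets of the plane: [rays] gives the ray (of H,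
   or external ray of f) of each angle, and [fixed] is the set of the angles in
   [0, 2pi[ whose ray is fixed. *)

Definition one_fixed_repelling K theta (rays : R -> set R[i]) (fixed : set R)
    : Prop :=
  exists phi, [/\ fixed phi,
    rays @` fixed = [set rays phi] &
    locally_repelling K theta phi].

Definition two_fixed_repelling_neutral K theta (rays : R -> set R[i])
    (fixed : set R) : Prop :=
  exists phi1 phi2, [/\ fixed phi1 /\ fixed phi2,
    rays phi1 <> rays phi2,
    rays @` fixed = [set rays phi1; rays phi2],
    locally_repelling K theta phi1 &
    neutral K theta phi2 /\
      exists s : bool, repelling_on_side K theta s phi2 /\
                       attracting_on_side K theta (~~ s) phi2].

Definition three_fixed_attracting_repelling K theta (rays : R -> set R[i])
    (fixed : set R) : Prop :=
  exists phi1 phi2 phi3, [/\ [/\ fixed phi1, fixed phi2 & fixed phi3],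
    [/\ rays phi1 <> rays phi2, rays phi1 <> rays phi3 &
        rays phi2 <> rays phi3],
    rays @` fixed = [set rays phi1; rays phi2; rays phi3],
    locally_attracting K theta phi1 &
    locally_repelling K theta phi2 /\ locally_repelling K theta phi3].

Definition fixed_angles K theta : set R :=
  [set phi | angles phi /\ Htilde K theta phi = phi].

(* The property by which the classification of the fixed rays of H determines
   the constant K_theta (at most one number has it). *)
Definition is_Ktheta theta (Ktheta : R) : Prop :=
  1 < Ktheta /\ forall K, 1 < K ->
    [/\ K < Ktheta -> one_fixed_repelling K theta ray (fixed_angles K theta),
        K = Ktheta ->
          two_fixed_repelling_neutral K theta ray (fixed_angles K theta) &
        Ktheta < K ->
          three_fixed_attracting_repelling K theta ray (fixed_angles K theta)].

End Maps.

Section Quasiconformal.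
Context {R : realType}.
Implicit Types (U : set R[i]) (g : R[i] -> R[i]).

Definition absolutely_continuous (a b : R) (u : R -> R[i]) : Prop :=
  forall e : R, 0 < e -> exists2 d : R, 0 < d &
    forall (n : nat) (p q : 'I_n -> R),
      (forall i, a <= p i /\ p i <= q i /\ q i <= b) ->
      trivIset setT (fun i => `](p i), (q i)[%classic) ->
      \sum_(i < n) (q i - p i) < d ->
      \sum_(i < n) `|u (q i) - u (p i)| < e%:C.

Definition absolutely_continuous_on_lines U g : Prop :=
  forall a b a' b' : R, a < b -> a' < b' ->
    (forall x y : R, a <= x <= b -> a' <= y <= b' -> U (x +i* y)) ->
    {ae (@lebesgue_measure R), forall y, a' <= y <= b' ->
        absolutely_continuous a b (fun x => g (x +i* y))} /\
    {ae (@lebesgue_measure R), forall x, a <= x <= b ->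
        absolutely_continuous a' b' (fun y => g (x +i* y))}.

(* gx and gy are the partial derivatives of g at x + iy *)
Definition partial_derivatives g (x y : R) (gx gy : R[i]) : Prop :=
  [/\ is_derive x (1 : R) (fun t : R => complex.Re (g (t +i* y))) (complex.Re gx),
      is_derive x (1 : R) (fun t : R => complex.Im (g (t +i* y))) (complex.Im gx),
      is_derive y (1 : R) (fun t : R => complex.Re (g (x +i* t))) (complex.Re gy) &
      is_derive y (1 : R) (fun t : R => complex.Im (g (x +i* t))) (complex.Im gy)].

(* |g_zbar| <= k |g_z| almost everywhere in U *)
Definition dilatation_bounded U g (k : R) : Prop :=
  {ae (@lebesgue_measure R \x @lebesgue_measure R)%E, forall p : R * R,
    U (p.1 +i* p.2) ->
    exists gx gy : R[i], partial_derivatives g p.1 p.2 gx gy /\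
      `|(gx + (0 +i* 1) * gy) / 2| <= k%:C * `|(gx - (0 +i* 1) * gy) / 2|}.

Definition homeo_onto_open U g : Prop :=
  [/\ open (U : set R[i]^o),
      {in U &, injective g},
      (forall z, U z -> {for z, continuous (g : R[i]^o -> R[i]^o)}) &
      forall V : set R[i]^o, open V -> V `<=` U ->
        open (g @` V : set R[i]^o)].

(* The analytic definition of quasiconformality (Ahlfors, Lectures on
   quasiconformal mappings, definition B); the values of g outside U are
   irrelevant. *)
Definition quasiconformal_on U g : Prop :=
  [/\ homeo_onto_open U g,
      absolutely_continuous_on_lines U g &
      exists2 k : R, 0 <= k < 1 & dilatation_bounded U g k].

End Quasiconformal.

Section Bottcher.
Context {R : realType}.
Implicit Types (K theta phi : R) (c z : R[i]) (U : set R[i]).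

Definition nbhs_infinity U : Prop :=
  exists r : R, forall z, r%:C < `|z| -> U z.

Definition bottcher_coordinate K theta c U (psi : R[i] -> R[i]) : Prop :=
  [/\ nbhs_infinity U /\ fmap_c K theta c @` U `<=` U,
      quasiconformal_on U psi,
      nbhs_infinity (psi @` U),
      (forall V, nbhs_infinity V ->
        nbhs_infinity [set z | U z -> V (psi z)]) &
      forall z, U z -> Hmap K theta (psi z) = psi (fmap_c K theta c z)].

Definition external_ray U (psi : R[i] -> R[i]) phi : set R[i] :=
  [set z | U z /\ ray phi (psi z)].

Definition fixed_external_angles K theta c U psi : set R :=
  [set phi | angles phi /\
    fmap_c K theta c @` external_ray U psi phi `<=` external_ray U psi phi].

End Bottcher.

(* Main.v *)
Require Import Defs.
From mathcomp Require Import all_boot all_order all_algebra.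
From mathcomp Require Import all_classical all_reals all_analysis.
From mathcomp Require Import complex.
From mathcomp Require Import ring lra.

Import Order.TTheory GRing.Theory Num.Theory.

Local Open Scope classical_set_scope.
Local Open Scope ring_scope.
Local Open Scope complex_scope.

(** The classification of the fixed rays of [H] is what characterizes
    [Ktheta], so only its transfer from [H] to [f] has to be shown, and the
    semiconjugacy [psi \o f = H \o psi] gives it.

    The external ray of angle [phi] is [U] intersected with the preimage under
    [psi] of the ray of angle [phi].  As the image of [psi] contains a
    neighbourhood of infinity, every external ray has a point that [psi] sends
    to a nonzero point of the corresponding ray.  Hence the external ray
    determines the ray ([external_ray_inj]), and it is fixed by [f] exactly
    when the ray is fixed by [H] ([fixed_external_anglesE]): since [H] is
    homogeneous of degree two over the positive reals, it sends a ray into a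
    ray, so the image of one nonzero point decides whether a ray is fixed.

    The external rays are therefore the images of the rays under
    [external_trace], which keeps distinct rays distinct, while the set of
    fixed angles is the same for [f] as for [H].  The nature of a fixed
    external ray is by definition that of the ray, so each of the three cases
    follows from the corresponding one for [H]. *)

Lemma norm_expi {R : realType} (a : R) : `|expi a| = 1.
Proof. by rewrite normc_def /= cos2Dsin2 sqrtr1. Qed.

Lemma expi_neq0 {R : realType} (a : R) : expi a != 0.
Proof. by rewrite -normr_gt0 norm_expi. Qed.

(** The difference of the two angles has cosine 1 and absolute value less
    than [2 * pi], which leaves only 0. *)
Lemma expi_inj {R : realType} (a b : R) :
  angles a -> angles b -> expi a = expi b -> a = b.
Proof.
wlog leab : a b / a <= b.
  move=> hw ha hb e; case: (leP a b) => h; first exact: hw.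
  by apply/esym/hw => //; exact: ltW.
rewrite /angles /= => /andP[a0 a2] /andP[b0 b2] [ec es].
have c1 : cos (b - a) = 1 by rewrite cosB ec es -!expr2 cos2Dsin2.
case: (leP (b - a) pi) => h.
  have /eqP : b - a = 0.
    by apply: cos_inj; rewrite ?cos0 // in_itv /= ?pi_ge0 ?lexx ?subr_ge0 ?leab.
  by rewrite subr_eq0 => /eqP.
(* The cosine is injective on [0, pi] only, so a difference d beyond pi is
   replaced by 2 pi - d, which would then be 0 although d < 2 pi. *)
have /eqP : pi *+ 2 - (b - a) = 0.
  apply: cos_inj; first last.
  - by rewrite cosB cos2pi sin2pi c1 cos0 mul0r addr0 mulr1.
  - by rewrite in_itv /= pi_ge0 lexx.
  - by rewrite in_itv /=; apply/andP; split; lra.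
by lra.
Qed.

Lemma polar_form {R : realType} (z : R[i]) :
  exists a, angles a /\ z = `|z| * expi a.
Proof.
have [->|z0] := eqVneq z 0.
  exists 0; split; last by rewrite normr0 mul0r.
  by rewrite /angles /= lexx mulr_gt0 ?pi_gt0.
set w := z / `|z|.
have nz : `|z| != 0 by rewrite normr_eq0.
suff [a [ha wa]] : exists a, angles a /\ w = expi a.
  by exists a; split=> //; rewrite -wa /w mulrC divfK.
have : `|w| = 1 by rewrite normrM normfV normr_id divff.
clearbody w; case: w => x y; rewrite normc_def /= => -[nw].
have {}nw : x ^+ 2 + y ^+ 2 = 1.
  rewrite -[LHS]sqr_sqrtr ?nw ?expr1n //.
  by rewrite addr_ge0 ?sqr_ge0.
(* The arc cosine covers the upper half circle; the lower one is obtained by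
   reflection in the real axis. *)
have x1 : -1 <= x <= 1 by apply/andP; split; nra.
have sy : sin (acos x) = `|y|.
  by rewrite sin_acos // (_ : 1 - x ^+ 2 = y ^+ 2) ?sqrtr_sqr //; lra.
have cx : cos (acos x) = x by apply: acosK; rewrite in_itv.
have pp := @pi_gt0 R.
have a0 := acos_ge0 x1; have ap := acos_lepi x1.
case: (leP 0 y) => hy.
  exists (acos x); split; first by rewrite /angles /=; apply/andP; split; lra.
  by rewrite /expi cx sy ger0_norm.
have a1 : 0 < acos x.
  rewrite lt_neqAle a0 andbT eq_sym; apply/eqP => e.
  by move: sy; rewrite e sin0 => /esym/eqP; rewrite normr_eq0 lt_eqF.
exists (pi *+ 2 - acos x); split.
  by rewrite /angles /=; apply/andP; split; lra.
rewrite /expi cosB sinB cos2pi sin2pi cx sy ltr0_norm //.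
by congr (_ +i* _); ring.
Qed.

Lemma argP {R : realType} (z : R[i]) :
  angles (arg z) /\ z = `|z| * expi (arg z).
Proof. exact: (xgetPex 0 (polar_form z)). Qed.

Lemma ray_norm {R : realType} (phi : R) (z : R[i]) :
  ray phi z -> z = `|z| * expi phi.
Proof.
move=> [t t0 ->]; rewrite normrM norm_expi mulr1 ger0_norm //.
by rewrite ler0c.
Qed.

Lemma ray_meet {R : realType} (a b : R) (z : R[i]) :
  z != 0 -> ray a z -> ray b z -> expi a = expi b.
Proof.
move=> z0 /ray_norm za /ray_norm zb.
have nz : `|z| != 0 by rewrite normr_eq0.
by apply: (mulfI nz); rewrite -za -zb.
Qed.

Lemma ray_arg {R : realType} (z : R[i]) : ray (arg z) z.
Proof.
have [_ zE] := argP z; rewrite normc_def in zE.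
by exists (Num.sqrt (complex.Re z ^+ 2 + complex.Im z ^+ 2)).
Qed.

Lemma ray_argP {R : realType} (phi : R) (z : R[i]) :
  z != 0 -> angles phi -> arg z = phi <-> ray phi z.
Proof.
move=> z0 hphi; split=> [<-|zphi]; first exact: ray_arg.
apply: expi_inj => //; first exact: (argP z).1.
exact: ray_meet _ _ _ z0 (ray_arg z) zphi.
Qed.

Lemma ray_scale {R : realType} (phi t : R) (z : R[i]) :
  0 < t -> ray phi (t%:C * z) <-> ray phi z.
Proof.
move=> t0; have tC : t%:C != 0 :> R[i].
  by rewrite gt_eqF // -[0]/(0%:C) ltcR.
split=> -[s s0 e]; last first.
  by exists (t * s); [rewrite mulr_ge0 // ltW|rewrite e rmorphM mulrA].
exists (t^-1 * s); first by rewrite mulr_ge0 // invr_ge0 ltW.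
by apply: (mulfI tC); rewrite e mulrA -rmorphM /= mulrA divff ?gt_eqF // mul1r.
Qed.

Lemma hmap_scale {R : realType} (K theta t : R) (z : R[i]) :
  hmap K theta (t%:C * z) = t%:C * hmap K theta z.
Proof.
have -> : hmap K theta (t%:C * z) = ((K + 1) / 2)%:C * (t%:C * z) +
    expi (2 * theta) * ((K - 1) / 2)%:C * (t%:C * z^*).
  congr (_ + _ * _); transitivity (t%:C^* * z^*); first exact: rmorphM.
  by congr (_ * _); exact: conjc_real.
by rewrite /hmap; ring.
Qed.

Lemma Hmap_scale {R : realType} (K theta t : R) (z : R[i]) :
  Hmap K theta (t%:C * z) = (t ^+ 2)%:C * Hmap K theta z.
Proof. by rewrite /Hmap hmap_scale exprMn rmorphXn. Qed.

(** The two terms of [hmap K theta z] have moduli proportional to [K + 1] and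
    [K - 1], so they cannot cancel. *)
Lemma Hmap_neq0 {R : realType} (K theta : R) (z : R[i]) :
  1 < K -> z != 0 -> Hmap K theta z != 0.
Proof.
move=> K1 z0; rewrite /Hmap expf_eq0 /= /hmap addr_eq0; apply/eqP => e.
have := congr1 Num.norm e.
rewrite normrN !normrM norm_expi mul1r norm_conjC.
have nz : `|z| != 0 by rewrite normr_eq0.
have nrm (x : R) : 0 <= x -> `|x%:C| = x%:C :> R[i].
  by move=> x0; rewrite ger0_norm // ler0c.
by move=> /(mulIf nz); rewrite !nrm; [move=> -[]|..]; lra.
Qed.

(** By homogeneity, the image of any single nonzero point of the ray decides
    whether the ray is fixed. *)
Lemma Htilde_fixedP {R : realType} (K theta phi t : R) :
  1 < K -> angles phi -> 0 < t ->
  Htilde K theta phi = phi <-> ray phi (Hmap K theta (t%:C * expi phi)).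
Proof.
move=> K1 hphi t0; rewrite Hmap_scale ray_scale ?exprn_gt0 //.
by apply: ray_argP => //; apply: Hmap_neq0 => //; exact: expi_neq0.
Qed.

(** The external ray as a function of the ray instead of its angle: a list of
    all the fixed rays is then carried to a list of all the fixed external rays
    by taking images. *)
Definition external_trace {R : realType} (U : set R[i]) (psi : R[i] -> R[i])
  (S : set R[i]) : set R[i] := U `&` psi @^-1` S.

Lemma external_rayE {R : realType} (U : set R[i]) psi :
  external_ray U psi = external_trace U psi \o ray.
Proof. by []. Qed.

Lemma external_ray_point {R : realType} (U : set R[i]) psi (phi : R) :
  nbhs_infinity (psi @` U) ->
  exists2 z, U z & exists2 t, 0 < t & psi z = t%:C * expi phi.
Proof.
move=> [r hr]; pose t := `|r| + 1.
have t0 : 0 < t by rewrite ltr_wpDl.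
have [z Uz zt] : (psi @` U) (t%:C * expi phi).
  apply: hr; rewrite normrM norm_expi mulr1 ger0_norm ?ler0c ?ltW // ltcR.
  by rewrite (le_lt_trans (ler_norm r)) // ltrDl.
by exists z => //; exists t.
Qed.

(** Two rays with a common nonzero point are equal, and an external ray has a
    point over a nonzero point of its ray. *)
Lemma external_ray_inj {R : realType} (U : set R[i]) psi (a b : R) :
  nbhs_infinity (psi @` U) ->
  external_ray U psi a = external_ray U psi b -> ray a = ray b.
Proof.
move=> /(external_ray_point U psi a)[z Uz [t t0 zt]] eE.
have za : ray a (psi z) by exists t => //; exact: ltW.
have [_ zb] : external_ray U psi b z by rewrite -eE.
have z0 : psi z != 0.
  by rewrite zt mulf_neq0 ?expi_neq0 // gt_eqF // -[0]/(0%:C) ltcR.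
by rewrite /ray (ray_meet _ _ _ z0 za zb).
Qed.

(** If the external ray is fixed, one of its points over a nonzero point of the
    ray shows that [H] keeps the direction of the ray.  Conversely a fixed ray
    is invariant under [H], hence so is its preimage under [psi] in [U]. *)
Lemma fixed_external_anglesE {R : realType} (K theta : R) c (U : set R[i]) psi :
  1 < K -> bottcher_coordinate K theta c U psi ->
  fixed_external_angles K theta c U psi = fixed_angles K theta.
Proof.
move=> K1 [[_ fU] _ imU _ conj]; apply/seteqP; split=> phi [hphi fix_phi];
  split=> //.
  have [z Uz [t t0 zt]] := external_ray_point U psi phi imU.
  apply/(Htilde_fixedP K theta phi t K1 hphi t0); rewrite -zt conj //.
  suff /fix_phi[_] : (fmap_c K theta c @` external_ray U psi phi)
    (fmap_c K theta c z) by [].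
  by exists z => //; split=> //; exists t => //; exact: ltW.
move=> _ [z [Uz [t t0 zt]] <-]; split; first by apply: fU; exists z.
(* The point of the ray may be the origin, which H fixes. *)
rewrite -conj // zt; have [-> {t0 zt}|tn0] := eqVneq t 0.
  by exists 0 => //; rewrite /Hmap hmap_scale !mul0r expr0n.
by apply/Htilde_fixedP => //; rewrite lt_neqAle eq_sym tn0.
Qed.

Theorem corollary2p5 (R : realType) (theta Ktheta : R)
    (htheta : - (pi / 2) < theta <= pi / 2)
    (hKtheta : is_Ktheta theta Ktheta)
    (K : R) (hK : 1 < K) (c : R[i])
    (U : set R[i]) (psi : R[i] -> R[i])
    (hpsi : bottcher_coordinate K theta c U psi) :
  [/\ K < Ktheta ->
        one_fixed_repelling K theta
          (external_ray U psi) (fixed_external_angles K theta c U psi),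
      K = Ktheta ->
        two_fixed_repelling_neutral K theta
          (external_ray U psi) (fixed_external_angles K theta c U psi) &
      Ktheta < K ->
        three_fixed_attracting_repelling K theta
          (external_ray U psi) (fixed_external_angles K theta c U psi)].
Proof.
rewrite (fixed_external_anglesE _ _ _ _ _ hK hpsi).
have imU : nbhs_infinity (psi @` U) by case: hpsi.
have inj a b := external_ray_inj U psi a b imU.
have [_ /(_ K hK)[one two three]] := hKtheta.
split=> [/one|/two|/three].
- move=> [phi [fix_phi rays rep]]; exists phi; split=> //.
  by rewrite external_rayE -image_comp rays image_set1.
- move=> [phi1 [phi2 [fix_phi neq rays rep neut]]]; exists phi1, phi2.
  split=> //; first by move/inj.
  by rewrite external_rayE -image_comp rays image_setU !image_set1.
- move=> [phi1 [phi2 [phi3 [fix_phi [n12 n13 n23] rays att rep]]]].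
  exists phi1, phi2, phi3; split=> //; first by split=> /inj.
  by rewrite external_rayE -image_comp rays !image_setU !image_set1.
Qed.
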